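(* Let $Y=XB^*+C^*+\mathcal E$ with $X\in\mathbb R^{n\times p}$, $B^*\in\mathbb R^{p\times m}$, $C^*\in\mathbb R^{n\times m}$, and $\mathcal E\in\mathbb R^{n\times m}$ having independent and identically distributed $N(0,\sigma^2)$ entries. Let $q=\mathrm{rank}(X)$, $r\ge1$, and $P(C;\lambda)=\sum_{i=1}^nP(\|c_i\|_2;\lambda)$, where $c_i^T$ is the $i$th row of $C$ and $P(\cdot;\lambda)$ satisfies $P(0;\lambda)=0$ and $P(t;\lambda)\ge P_H(t;\lambda)$ for all $t$, with $$P_H(t;\lambda)=(-t^2/2+\lambda|t|)1_{|t|<\lambda}+(\lambda^2/2)1_{|t|\ge\lambda}.$$ Suppose moreover that $P$ is a bounded nonconvex penalty satisfying $P(t;\lambda)\lesssim\lambda^2$ for any $t\in\mathbb R$. Let $\lambda=A\sigma(m+\log n)^{1/2}$ with $A$ a constant, and let $(\hat B,\hat C)$ be a global minimizer of $$\min_{B,C}\ \tfrac12\|Y-XB-C\|_F^2+P(C;\lambda)\quad\text{subject to }\mathrm{rank}(B)\le r .$$ Then, for any sufficiently large constant $A$, $$E\{M(\hat B-B^*,\hat C-C^* )\}\ \lesssim\ \inf_{(B,C):\,\mathrm{rank}(B)\le r}\big\{M(B-B^*,C-C^* )+\sigma^2(q+m)r+\sigma^2J(C)m+\sigma^2J(C)\log n\big\}.$$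
   Context: $M(B,C)=\|XB+C\|_F^2$, with $\|\cdot\|_F$ the Frobenius norm. $J(C)=\|C\|_{2,0}$ is the number of nonzero rows of $C$. $\lesssim$ means that the inequality holds up to a multiplicative constant not depending on the problem quantities $n,m,p,q,r,\sigma,X,B^*,C^*,B,C$ (in the conclusion it may depend on the constant $A$ and on the constant in $P(t;\lambda)\lesssim\lambda^2$). *)

(* Defs.v *)
From HB Require Import structures.
From mathcomp Require Import all_boot all_order all_algebra.
From mathcomp Require Import all_classical all_reals all_analysis.

Set Implicit Arguments.
Unset Strict Implicit.
Unset Printing Implicit Defensive.

Import Order.TTheory GRing.Theory Num.Theory.
Import numFieldNormedType.Exports.

Local Open Scope classical_set_scope.
Local Open Scope ring_scope.

(* The library's norm on matrices is the sup norm, hence the explicit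
   Frobenius and Euclidean norms below. *)
Definition frob_norm (R : realType) (n m : nat) (U : 'M[R]_(n, m)) : R :=
  Num.sqrt (\sum_(i < n) \sum_(j < m) U i j ^+ 2).

Definition l2_norm (R : realType) (m : nat) (u : 'rV[R]_m) : R :=
  Num.sqrt (\sum_(j < m) u 0 j ^+ 2).

(* M(B, C) = ||X B + C||_F^2 *)
Definition Mloss (R : realType) (n m p : nat) (X : 'M[R]_(n, p))
    (B : 'M[R]_(p, m)) (C : 'M[R]_(n, m)) : R :=
  frob_norm (X *m B + C) ^+ 2.

(* J(C) = ||C||_{2,0}, the number of nonzero rows *)
Definition Jrows (R : realType) (n m : nat) (C : 'M[R]_(n, m)) : nat :=
  #|[pred i : 'I_n | row i C != 0]|.

Definition P_H (R : realType) (t lambda : R) : R :=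
  if `|t| < lambda then - (t ^+ 2 / 2) + lambda * `|t| else lambda ^+ 2 / 2.

(* The second argument of [P] is the regularization parameter. *)
Definition row_penalty (R : realType) (P : R -> R -> R) (n m : nat)
    (C : 'M[R]_(n, m)) (lambda : R) : R :=
  \sum_(i < n) P (l2_norm (row i C)) lambda.

Definition dominates_P_H (R : realType) (P : R -> R -> R) (lambda : R) : Prop :=
  P 0 lambda = 0 /\ forall t : R, P_H t lambda <= P t lambda.

(* [cP] is the implicit constant in P(t; lambda) <~ lambda^2. *)
Definition bounded_nonconvex_penalty (R : realType) (P : R -> R -> R)
    (cP lambda : R) : Prop :=
  [/\ bounded_fun (fun t : R => P t lambda),
      ~ convex_function (setT : set R^o) (fun t : R^o => P t lambda : R^o)
    & forall t : R, P t lambda <= cP * lambda ^+ 2].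

Definition objective (R : realType) (P : R -> R -> R) (lambda : R)
    (n m p : nat) (X : 'M[R]_(n, p)) (Y : 'M[R]_(n, m))
    (B : 'M[R]_(p, m)) (C : 'M[R]_(n, m)) : R :=
  2^-1 * frob_norm (Y - X *m B - C) ^+ 2 + row_penalty P C lambda.

Definition is_global_minimizer (R : realType) (P : R -> R -> R) (lambda : R)
    (n m p : nat) (X : 'M[R]_(n, p)) (Y : 'M[R]_(n, m)) (r : nat)
    (Bh : 'M[R]_(p, m)) (Ch : 'M[R]_(n, m)) : Prop :=
  (\rank Bh <= r)%N /\
  forall (B : 'M[R]_(p, m)) (C : 'M[R]_(n, m)), (\rank B <= r)%N ->
    objective P lambda X Y Bh Ch <= objective P lambda X Y B C.

Definition mutually_independent (d : measure_display) (T : measurableType d)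
    (R : realType) (Pr : probability T R) (I : finType)
    (Z : I -> {RV Pr >-> R}) : Prop :=
  forall (S : {set I}) (D : I -> set R), (forall i, measurable (D i)) ->
    (Pr (\bigcap_(i in [set` S]) (Z i @^-1` D i)) =
     \prod_(i in S) Pr (Z i @^-1` D i))%E.

(* N(0, sigma^2); the law is compared with [normal_prob], whose second
   parameter is the standard deviation, on Borel sets only, since both are
   functions on arbitrary sets. *)
Definition centered_gaussian (d : measure_display) (T : measurableType d)
    (R : realType) (Pr : probability T R) (sigma : R)
    (Z : {RV Pr >-> R}) : Prop :=
  forall D : set R, measurable D ->
    distribution Pr Z D = normal_prob 0 sigma D.

Definition iid_gaussian_entries (d : measure_display) (T : measurableType d)
    (R : realType) (Pr : probability T R) (n m : nat) (sigma : R)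
    (E : 'I_n * 'I_m -> {RV Pr >-> R}) : Prop :=
  mutually_independent E /\ forall ij, centered_gaussian sigma (E ij).

Definition noise_matrix (d : measure_display) (T : measurableType d)
    (R : realType) (Pr : probability T R) (n m : nat)
    (E : 'I_n * 'I_m -> {RV Pr >-> R}) (w : T) : 'M[R]_(n, m) :=
  \matrix_(i < n, j < m) E (i, j) w.

Definition oracle_bound (R : realType) (n m p : nat) (sigma : R)
    (X : 'M[R]_(n, p)) (r : nat) (Bs : 'M[R]_(p, m)) (Cs : 'M[R]_(n, m))
    (B : 'M[R]_(p, m)) (C : 'M[R]_(n, m)) : R :=
  Mloss X (B - Bs) (C - Cs)
  + sigma ^+ 2 * ((\rank X)%:R + m%:R) * r%:R
  + sigma ^+ 2 * (Jrows C)%:R * m%:R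
  + sigma ^+ 2 * (Jrows C)%:R * ln n%:R.

(* Main.v *)
(* Comparing the objective at the minimizer with its value at [(B, C)], the
   noise enters through [<E, D>] with [D = X W + (Ch - C)], [rank W <= 2 r].
   Completing the square in [Ch], the penalty [P >= P_H] dominates the cost of
   hard thresholding, so [Ch] may be replaced by a row-sparse matrix carrying
   the penalty [lambda^2 / 8] per nonzero row. For a row support [J], the
   matrices [D] have a finite net of log-cardinality of order
   [(q + m) r + |J| m]. Exponential moments of [<E, V>] over all nets, weighted
   by [n^-|J|] to pay for the choice of [J], give
   [<E, D> <= |D|^2 / 8 + O(sigma^2) ((q + m) r + |J| (m + log n) + Z)] with
   [E Z] bounded; for large [A] the [J]-term is absorbed by the penalty. *)
Require Import Defs.
From HB Require Import structures.
From mathcomp Require Import all_boot all_order all_algebra.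
From mathcomp Require Import all_classical all_reals all_analysis.
From mathcomp Require Import measurable_realfun.
From mathcomp Require Import ring lra.
Import Order.TTheory GRing.Theory Num.Theory.
Import numFieldNormedType.Exports.
Set Implicit Arguments.
Unset Strict Implicit.
Unset Printing Implicit Defensive.
Local Open Scope ring_scope.

(** * Frobenius inner product *)

Definition mxdot (R : realType) (n m : nat) (U V : 'M[R]_(n, m)) : R :=
  \sum_(i < n) \sum_(j < m) U i j * V i j.

Lemma mxdotE (R : realType) (n m : nat) (U V : 'M[R]_(n, m)) :
  mxdot U V = \tr (U^T *m V).
Proof.
rewrite /mxdot exchange_big; apply: eq_bigr => j _; rewrite mxE.
by apply: eq_bigr => i _; rewrite mxE.
Qed.

Lemma mxdotC (R : realType) (n m : nat) (U V : 'M[R]_(n, m)) :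
  mxdot U V = mxdot V U.
Proof. by apply: eq_bigr => i _; apply: eq_bigr => j _; rewrite mulrC. Qed.

Lemma mxdot0l (R : realType) (n m : nat) (U : 'M[R]_(n, m)) : mxdot 0 U = 0.
Proof. by rewrite mxdotE trmx0 mul0mx mxtrace0. Qed.

Lemma mxdot0r (R : realType) (n m : nat) (U : 'M[R]_(n, m)) : mxdot U 0 = 0.
Proof. by rewrite mxdotC mxdot0l. Qed.

Lemma mxdotDr (R : realType) (n m : nat) (U V W : 'M[R]_(n, m)) :
  mxdot U (V + W) = mxdot U V + mxdot U W.
Proof. by rewrite !mxdotE mulmxDr raddfD. Qed.

Lemma mxdotZr (R : realType) (n m : nat) (a : R) (U V : 'M[R]_(n, m)) :
  mxdot U (a *: V) = a * mxdot U V.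
Proof. by rewrite !mxdotE -scalemxAr mxtraceZ. Qed.

Lemma mxdotDl (R : realType) (n m : nat) (U V W : 'M[R]_(n, m)) :
  mxdot (V + W) U = mxdot V U + mxdot W U.
Proof. by rewrite mxdotC mxdotDr !(mxdotC U). Qed.

Lemma mxdotZl (R : realType) (n m : nat) (a : R) (U V : 'M[R]_(n, m)) :
  mxdot (a *: V) U = a * mxdot V U.
Proof. by rewrite mxdotC mxdotZr mxdotC. Qed.

Lemma mxdotBr (R : realType) (n m : nat) (U V W : 'M[R]_(n, m)) :
  mxdot U (V - W) = mxdot U V - mxdot U W.
Proof. by rewrite -scaleN1r mxdotDr mxdotZr mulN1r. Qed.

Lemma mxdotBl (R : realType) (n m : nat) (U V W : 'M[R]_(n, m)) :
  mxdot (V - W) U = mxdot V U - mxdot W U.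
Proof. by rewrite mxdotC mxdotBr !(mxdotC U). Qed.

Lemma mxdot_ge0 (R : realType) (n m : nat) (U : 'M[R]_(n, m)) :
  0 <= mxdot U U.
Proof.
by apply: sumr_ge0 => i _; apply: sumr_ge0 => j _; rewrite -expr2 sqr_ge0.
Qed.

Lemma mxdot_eq0 (R : realType) (n m : nat) (U : 'M[R]_(n, m)) :
  mxdot U U = 0 -> U = 0.
Proof.
move=> U0; apply/matrixP => i j; rewrite mxE; apply/eqP.
rewrite -sqrf_eq0 expr2.
have U0' : \sum_(j < m) U i j * U i j = 0.
  apply: (psumr_eq0P _ U0) => // i' _.
  by apply: sumr_ge0 => j' _; rewrite -expr2 sqr_ge0.
apply/eqP; apply: (psumr_eq0P _ U0') => // j' _.
by rewrite -expr2 sqr_ge0.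
Qed.

Lemma mxdot_mull (R : realType) (n k m : nat) (A : 'M[R]_(n, k))
    (U : 'M[R]_(k, m)) (V : 'M[R]_(n, m)) :
  mxdot (A *m U) V = mxdot U (A^T *m V).
Proof. by rewrite !mxdotE trmx_mul mulmxA. Qed.

Lemma mxdot_mulr (R : realType) (n k m : nat) (U : 'M[R]_(n, k))
    (B : 'M[R]_(k, m)) (V : 'M[R]_(n, m)) :
  mxdot (U *m B) V = mxdot U (V *m B^T).
Proof. by rewrite !mxdotE trmx_mul -mulmxA mxtrace_mulC mulmxA. Qed.

Lemma mxdot_trmx (R : realType) (n m : nat) (U V : 'M[R]_(n, m)) :
  mxdot U^T V^T = mxdot U V.
Proof. by rewrite !mxdotE trmxK mxtrace_mulC -mxtrace_tr trmx_mul trmxK. Qed.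

Lemma mxdot_sqD_le (R : realType) (n m : nat) (U V : 'M[R]_(n, m)) :
  mxdot (U + V) (U + V) <= 2 * mxdot U U + 2 * mxdot V V.
Proof.
have := mxdot_ge0 (U - V).
by rewrite !mxdotDr !mxdotDl -scaleN1r !mxdotZr !mxdotZl (mxdotC V U); lra.
Qed.

(** * Orthonormal bases of row and column spaces *)

(** Gram-Schmidt by induction on the number of rows: the first row is projected off the orthonormal
    family built from the others, then normalized. *)
Lemma row_free_orthonormal (R : realType) (q n : nat) (M : 'M[R]_(q, n)) :
  row_free M -> exists Q : 'M[R]_(q, n), Q *m Q^T = 1%:M /\ (M <= Q)%MS.
Proof.
elim: q M => [|q IH] M fM.
  by exists M; rewrite !flatmx0; split; [apply: flatmx0 | rewrite sub0mx].
pose v : 'rV_n := usubmx (M : 'M[R]_(1 + q, n)).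
pose N : 'M[R]_(q, n) := dsubmx (M : 'M[R]_(1 + q, n)).
have ME : M = col_mx v N by rewrite /v /N vsubmxK.
have rM : \rank (col_mx v N) = q.+1 by rewrite -ME; exact/eqP.
have rN : (q <= \rank N)%N.
  have := (mxrank_adds_leqif v N).1; rewrite addsmxE rM.
  by move/leq_trans => /(_ (1 + \rank N)%N); rewrite leq_add2r rank_leq_row => /(_ erefl).
have fN : row_free N by rewrite /row_free eqn_leq rank_leq_row.
have [Q0 [Q0o NQ0]] := IH N fN.
pose v' := v - v *m Q0^T *m Q0.
have v'Q0 : v' *m Q0^T = 0.
  by rewrite mulmxBl -[_ *m Q0 *m _]mulmxA Q0o mulmx1 subrr.
have v'0 : v' != 0.
  apply/negP => /eqP v'0.
  have vQ0 : (v <= Q0)%MS.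
    by move/eqP: v'0; rewrite subr_eq0 => /eqP ->; rewrite submxMl.
  have : (col_mx v N <= Q0)%MS by rewrite col_mx_sub vQ0.
  by move/mxrankS; rewrite rM => /leq_trans /(_ (rank_leq_row _)); rewrite ltnn.
have c0 : 0 < mxdot v' v'.
  rewrite lt_neqAle mxdot_ge0 andbT eq_sym.
  by apply: contra v'0 => /eqP /mxdot_eq0 ->.
pose c := Num.sqrt (mxdot v' v').
have cc : c * c = mxdot v' v' by rewrite -expr2 sqr_sqrtr ?mxdot_ge0.
have cn0 : c != 0 by rewrite gt_eqF // sqrtr_gt0.
have v'v' : v' *m v'^T = (mxdot v' v')%:M.
  by rewrite [LHS]mx11_scalar mxdotE mxtrace_mulC /mxtrace big_ord1.
have QQ : col_mx (c^-1 *: v') Q0 *m (col_mx (c^-1 *: v') Q0)^T = 1%:M.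
  have Q0v' : Q0 *m v'^T = 0 by rewrite -[LHS]trmxK trmx_mul trmxK v'Q0 trmx0.
  rewrite tr_col_mx mul_col_row linearZ /= -!scalemxAl -!scalemxAr v'Q0 Q0o Q0v'.
  rewrite v'v' !scaler0 -cc !scale_scalar_mx.
  have -> : c^-1 * (c^-1 * (c * c)) = 1 by field.
  by rewrite -scalar_mx_block.
exists (col_mx (c^-1 *: v') Q0); split; first exact: QQ.
rewrite ME; suff: (col_mx v N <= col_mx (c^-1 *: v') Q0)%MS by [].
rewrite col_mx_sub; apply/andP; split; rewrite -addsmxE.
  have -> : v = c *: (c^-1 *: v') + v *m Q0^T *m Q0.
    by rewrite scalerA divff // scale1r /v' subrK.
  apply: addmx_sub; last exact: submx_trans (submxMl _ _) (addsmxSr _ _).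
  exact: submx_trans (scalemx_sub _ (submx_refl _)) (addsmxSl _ _).
exact: submx_trans NQ0 (addsmxSr _ _).
Qed.

(** [Q] stacks an orthonormal basis of the row space of [M] over zero rows, so that it has exactly
    [s] rows whatever the rank; this padding is why [Q] is a contraction and not an isometry. *)
Lemma row_basis_contraction (R : realType) (k n s : nat) (M : 'M[R]_(k, n)) :
  (\rank M <= s)%N ->
  exists Q : 'M[R]_(s, n), M = M *m Q^T *m Q /\
    forall (a : nat) (x : 'M[R]_(a, s)), mxdot (x *m Q) (x *m Q) <= mxdot x x.
Proof.
move=> rMs; have [Q0 [Q0o MQ0]] := @row_free_orthonormal R _ _ _ (row_base_free M).
rewrite eq_row_base in MQ0; rewrite -(subnKC rMs); move: (s - _)%N => e.
move: (\rank M) Q0 Q0o MQ0 => h Q0 Q0o /submxP[D MD].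
have MQ : M = M *m Q0^T *m Q0.
  by rewrite MD -[_ *m Q0 *m _]mulmxA Q0o mulmx1.
exists (col_mx Q0 0); split.
  by rewrite -mulmxA tr_col_mx mul_row_col mulmx0 addr0 mulmxA.
move=> a x; rewrite -[x in x *m _]hsubmxK mul_row_col mulmx0 addr0.
rewrite mxdot_mulr -[_ *m Q0 *m _]mulmxA Q0o mulmx1 /mxdot; apply: ler_sum => i _.
rewrite big_split_ord /=.
rewrite [X in _ <= X + _](eq_bigr (fun j => lsubmx x i j * lsubmx x i j)).
  by rewrite lerDl; apply: sumr_ge0 => j _; rewrite -expr2 sqr_ge0.
by move=> j _; rewrite mxE.
Qed.

Lemma col_basis_contraction (R : realType) (n k s : nat) (M : 'M[R]_(n, k)) :
  (\rank M <= s)%N ->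
  exists Q : 'M[R]_(n, s), M = Q *m (Q^T *m M) /\
    forall (a : nat) (x : 'M[R]_(s, a)), mxdot (Q *m x) (Q *m x) <= mxdot x x.
Proof.
rewrite -mxrank_tr => /row_basis_contraction[Q [MQ Qc]].
exists Q^T; split.
  by apply: trmx_inj; rewrite {1}MQ !trmx_mul !trmxK.
by move=> a x; have := Qc a x^T; rewrite -mxdot_trmx trmx_mul !trmxK mxdot_trmx.
Qed.

(** * Nets for sums of low-rank and row-sparse matrices *)

Lemma sum_geometric_half_le (F : realFieldType) (B : nat) :
  \sum_(a < B) 2^-1 ^+ a <= 2 :> F.
Proof.
have -> : \sum_(a < B) 2^-1 ^+ a = 2 - 2 * 2^-1 ^+ B :> F.
  elim: B => [|B IH]; first by rewrite big_ord0 expr0; lra.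
  by rewrite big_ord_recr IH /= exprS; lra.
by rewrite gerBl mulr_ge0 // exprn_ge0 // invr_ge0.
Qed.

(* Chernoff-style count: each [f] is weighted by [2 ^ (k - \sum_i (f i).2)]. *)
Lemma card_signed_grid_le (I : finType) (B k : nat) :
  (#|[pred f : {ffun I -> bool * 'I_B} | \sum_i ((f i).2 : nat) <= k]|
     <= 2 ^ k * 4 ^ #|I|)%N.
Proof.
rewrite -(ler_nat rat) natrM !natrX.
pose w (p : bool * 'I_B) : rat := 2^-1 ^+ p.2.
have w0 p : 0 <= w p by rewrite exprn_ge0 // invr_ge0.
have sw : \sum_p w p <= 4.
  rewrite -(pair_bigA _ (fun (b : bool) (a : 'I_B) => 2^-1 ^+ a)) big_bool /=.
  have := sum_geometric_half_le rat B; lra.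
apply: (@le_trans _ _ (2 ^+ k * \prod_(i : I) \sum_p w p)); last first.
  rewrite ler_wpM2l ?exprn_ge0 // -prodr_const.
  by apply: ler_prod => i _; rewrite sumr_ge0.
rewrite bigA_distr_bigA /= mulr_sumr -sum1_card natr_sum.
rewrite [leRHS](bigID [pred f : {ffun I -> bool * 'I_B} |
  (\sum_i ((f i).2 : nat) <= k)%N]) /=.
rewrite -[leLHS]addr0; apply: lerD; last first.
  by apply: sumr_ge0 => f _; rewrite mulr_ge0 ?exprn_ge0 ?prodr_ge0.
apply: ler_sum => f fk; rewrite /w prodrXr -(subnK fk) exprD -mulrA -exprMn.
by rewrite divff // expr1n mulr1 exprn_ege1.
Qed.

(* Entries are rounded to a grid of step [(a b)^(-1/2)], away from [0] exactly
   when this increases [mxdot g x], so no covering error is incurred. *)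
Lemma ball_net (R : realType) (a b : nat) :
  exists S : seq 'M[R]_(a, b),
  [/\ (size S <= 64 ^ (a * b))%N, (forall V, V \in S -> mxdot V V <= 4)
    & forall x g : 'M[R]_(a, b), mxdot x x <= 1 ->
        exists2 V, V \in S & mxdot g x <= mxdot g V].
Proof.
(* The levels kept in the grid satisfy [c <= c ^ 2 <= 4 * N], hence fit in ['I_B]. *)
pose N := (a * b)%N; pose B := (4 * N).+1.
pose F := {ffun 'I_a * 'I_b -> bool * 'I_B}.
pose d : R := (Num.sqrt N%:R)^-1.
pose V (f : F) : 'M[R]_(a, b) :=
  \matrix_(i, j) ((-1) ^+ (f (i, j)).1 * ((f (i, j)).2%:R * d)).
pose good := [pred f : F | (\sum_p (f p).2 ^ 2 <= 4 * N)%N].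
have cardN : #|{: 'I_a * 'I_b}| = N by rewrite card_prod !card_ord.
exists [seq V f | f <- enum good]; split.
- rewrite size_map -cardE.
  apply: (@leq_trans (2 ^ (4 * N) * 4 ^ N)); last first.
    by rewrite expnM -expnMn.
  rewrite -[X in (4 ^ X)%N]cardN; apply: leq_trans (card_signed_grid_le _ _ _).
  apply/subset_leq_card/fintype.subsetP => f; rewrite !inE => /(leq_trans _); apply.
  apply: leq_sum => p _; rewrite -mulnn.
  by case: (nat_of_ord _) => // n; rewrite leq_pmulr.
- move=> W /mapP[f]; rewrite mem_enum inE => fN ->.
  have -> : mxdot (V f) (V f) = d ^+ 2 * (\sum_p (f p).2 ^ 2)%N%:R :> R.
    rewrite natr_sum mulr_sumr.
    rewrite (eq_bigr (fun p => d ^+ 2 * ((f (p.1, p.2)).2 ^ 2)%:R)); last by case.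
    rewrite -(pair_bigA _ (fun i j => d ^+ 2 * ((f (i, j)).2 ^ 2)%:R)) /=.
    apply: eq_bigr => i _; apply: eq_bigr => j _; rewrite !mxE natrX.
    rewrite -expr2 exprMn sqrr_sign mul1r exprMn mulrC //.
  have [N0|N0] := posnP N.
    by rewrite /d N0 sqrtr0 invr0 expr0n /= mul0r.
  rewrite /d exprVn sqr_sqrtr // ler_pdivrMl ?ltr0n // mulrC -natrM ler_nat //.
move=> x g x1.
pose t i j := `|x i j| * Num.sqrt N%:R.
pose c i j := (Num.truncn (t i j) + (0 < g i j * x i j)%R)%N.
have t0 i j : 0 <= t i j by rewrite mulr_ge0 ?sqrtr_ge0.
have ct i j : (c i j)%:R <= t i j + 1.
  rewrite /c natrD lerD // ?truncn_le //; by case: (_ < _).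
have cN : (\sum_i \sum_j c i j ^ 2 <= 4 * N)%N.
  rewrite -(ler_nat R) natr_sum.
  under eq_bigr do rewrite natr_sum.
  have -> : (4 * N)%:R = 2 * N%:R + \sum_(i < a) \sum_(j < b) 2 :> R.
    rewrite !sumr_const !card_ord -mulrnA [(b * a)%N]mulnC -/N.
    by rewrite -[2 *+ N]mulr_natr -mulrDl -natrD natrM.
  (* By [(t + 1) ^ 2 <= 2 * t ^ 2 + 2], the squared levels sum to at most
     [2 * N * |x| ^ 2 + 2 * N]. *)
  apply: (@le_trans _ _ (2 * N%:R * mxdot x x + \sum_(i < a) \sum_(j < b) 2)); last first.
    by rewrite lerD2r ler_piMr // mulr_ge0.
  rewrite /mxdot mulr_sumr -big_split /=; apply: ler_sum => i _.
  rewrite mulr_sumr -big_split /=; apply: ler_sum => j _.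
  apply: (@le_trans _ _ ((t i j + 1) ^+ 2)).
    by rewrite natrX lerXn2r ?nnegrE // addr_ge0.
  have -> : 2 * N%:R * (x i j * x i j) = 2 * t i j ^+ 2.
    by rewrite /t exprMn real_normK ?num_real // sqr_sqrtr //; ring.
  have := sqr_ge0 (t i j - 1); rewrite !expr2; lra.
have cB i j : (c i j < B)%N.
  rewrite ltnS; apply: leq_trans cN.
  rewrite (bigD1 i) //= (bigD1 j) //= -addnA (@leq_trans (c i j ^ 2)) ?leq_addr //.
  by rewrite -mulnn; case: (c i j) => // n; rewrite leq_pmulr.
pose f : F := [ffun p => (x p.1 p.2 < 0, Ordinal (cB p.1 p.2))].
exists (V f).
  apply/mapP; exists f => //; rewrite mem_enum inE.
  rewrite (eq_bigr (fun p => c p.1 p.2 ^ 2)%N).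
    by rewrite -(pair_bigA _ (fun i j => c i j ^ 2)%N).
  by move=> p _; rewrite ffunE.
apply: ler_sum => i _; apply: ler_sum => j _; rewrite !mxE ffunE /=.
have N0 : 0 < Num.sqrt N%:R :> R.
  rewrite sqrtr_gt0 ltr0n muln_gt0.
  by rewrite (leq_ltn_trans _ (ltn_ord i)) // (leq_ltn_trans _ (ltn_ord j)).
have [x0|xn0] := eqVneq (x i j) 0.
  by rewrite /c /t x0 normr0 mul0r truncn0 mulr0 ltxx /= !mul0r !mulr0.
rewrite -{1}[x i j]mulr_sign_norm !mulrA.
have [gx|gx] := ltP 0 (g i j * x i j).
  have s0 : 0 <= g i j * (-1) ^+ (x i j < 0)%R.
    rewrite -(@pmulr_lge0 _ `|x i j|) ?normr_gt0 //.
    by rewrite -mulrA mulr_sign_norm ltW.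
  rewrite -[leRHS]mulrA ler_wpM2l // ler_pdivlMr // /c gx addn1.
  by rewrite -/(t i j) ltW // truncnS_gt.
have s0 : g i j * (-1) ^+ (x i j < 0)%R <= 0.
  by rewrite -(@pmulr_lle0 _ `|x i j|) ?normr_gt0 // -mulrA mulr_sign_norm.
rewrite -[leRHS]mulrA ler_wnM2l // ler_pdivrMr // /c ltNge gx addn0.
by rewrite truncn_le.
Qed.

(** A basis of the column space of [M] gives [k * m] coordinates; the net of the coordinate ball is
    mapped back by the contraction [Q]. *)
Lemma subspace_net (R : realType) (n p k m : nat) (M : 'M[R]_(n, p)) :
  (\rank M <= k)%N ->
  exists S : seq 'M[R]_(n, m),
  [/\ (size S <= 64 ^ (k * m))%N, (forall V, V \in S -> mxdot V V <= 4)
    & forall (W : 'M[R]_(p, m)) g, mxdot (M *m W) (M *m W) <= 1 ->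
        exists2 V, V \in S & mxdot g (M *m W) <= mxdot g V].
Proof.
move=> /col_basis_contraction[Q [MQ Qc]].
have [S [sS S4 Snet]] := ball_net R k m.
exists [seq Q *m V | V <- S]; split; first by rewrite size_map.
  by move=> _ /mapP[V VS ->]; apply: le_trans (Qc _ _) (S4 _ VS).
move=> W g MW1; pose x := Q^T *m M *m W.
have QxE : M *m W = Q *m x by rewrite {1}MQ /x !mulmxA.
(* [<Q^T M W, x> = <M W, Q x> = |M W| ^ 2], so [x] has the norm of [M W] although [Q] is only a
   contraction. *)
have x1 : mxdot x x <= 1.
  by rewrite {1}/x -mulmxA mxdot_mull trmxK -QxE.
have [V VS gV] := Snet x (Q^T *m g) x1.
exists (Q *m V); first exact: map_f.
have E y : mxdot g (Q *m y) = mxdot (Q^T *m g) y by rewrite mxdotC mxdot_mull mxdotC.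
by rewrite QxE !E.
Qed.

(* A matrix [H = M W] of rank at most [s] factors as [A Q] where [Q] is a
   contraction spanning its row space and [A = H Q^T] lies in the column space
   of [M]. Linear functionals of [A Q] are first maximized over [A] with [Q]
   fixed, then over [Q] with [A] in a net. *)
Lemma low_rank_net (R : realType) (n p q s m : nat) (M : 'M[R]_(n, p)) :
  (\rank M <= q)%N ->
  exists S : seq 'M[R]_(n, m),
  [/\ (size S <= 64 ^ (q * s + s * m))%N, (forall V, V \in S -> mxdot V V <= 16)
    & forall (W : 'M[R]_(p, m)) g, (\rank W <= s)%N ->
        mxdot (M *m W) (M *m W) <= 1 ->
        exists2 V, V \in S & mxdot g (M *m W) <= mxdot g V].
Proof.
move=> rM; have [S [sS S4 Snet]] := @subspace_net R n p q s M rM.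
have rS (A : 'M[R]_(n, s)) : (\rank A <= s)%N by exact: rank_leq_col.
pose T (A : 'M[R]_(n, s)) := projT1 (cid (@subspace_net R n s s m A (rS A))).
have TP A := projT2 (cid (@subspace_net R n s s m A (rS A))).
exists [seq 2 *: V | A <- S, V <- T A]; split.
- rewrite size_allpairs_dep sumnE big_map expnD.
  apply: (@leq_trans (size S * 64 ^ (s * m))); last by rewrite leq_mul2r sS orbT.
  rewrite -sum1_size big_distrl /=; apply: leq_sum => A _.
  by rewrite mul1n; case: (TP A).
- move=> _ /allpairsPdep[A [V [AS VT ->]]].
  have [_ /(_ _ VT) V4 _] := TP A.
  by rewrite mxdotZr mxdotZl; lra.
move=> W g rW H1; set H := M *m W in H1 *.
have [Q [HQ Qc]] : exists Q : 'M[R]_(s, m), H = H *m Q^T *m Q /\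
    forall (a : nat) (x : 'M[R]_(a, s)), mxdot (x *m Q) (x *m Q) <= mxdot x x.
  by apply: row_basis_contraction; apply: leq_trans rW; exact: mxrankM_maxr.
have A1 : mxdot (M *m (W *m Q^T)) (M *m (W *m Q^T)) <= 1.
  by rewrite mulmxA mxdot_mulr trmxK -/H -HQ.
have [A AS gA] := Snet _ (g *m Q^T) A1.
(* [A] has norm at most [2]: halving [Q] brings the product into the unit ball, and doubling the net
   points afterwards gives the bound [16]. *)
have B1 : mxdot (A *m (2^-1 *: Q)) (A *m (2^-1 *: Q)) <= 1.
  rewrite -scalemxAr mxdotZr mxdotZl.
  by have := Qc _ A; have := S4 _ AS; lra.
have [_ _ /(_ _ g B1)[V VT gV]] := TP A.
exists (2 *: V); first by apply/allpairsPdep; exists A, V.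
have E (y : 'M[R]_(n, s)) : mxdot g (y *m Q) = mxdot (g *m Q^T) y.
  by rewrite mxdotC mxdot_mulr mxdotC.
rewrite mulmxA -/H in gA; move: gV; rewrite HQ E -scalemxAr !mxdotZr E; lra.
Qed.

(** * Row supports *)

(** A matrix form of the projection onto the rows in [J]: support in [J] reads
    [row_mask R (~: J) *m C = 0], and masking [X *m W] amounts to masking [X]. *)
Definition row_mask (R : realType) (n : nat) (J : {set 'I_n}) : 'M[R]_n :=
  diag_mx (\row_i (i \in J)%:R).

Lemma mxrank_row_mask (R : realType) (n : nat) (J : {set 'I_n}) :
  (\rank (row_mask R J) <= #|J|)%N.
Proof.
pose A : 'M[R]_(n, #|J|) := \matrix_(i, k) (i == enum_val k)%:R.
suff -> : row_mask R J = A *m A^T.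
  by apply: leq_trans (mxrankM_maxl _ _) (rank_leq_col _).
apply/matrixP => i j; rewrite !mxE; under eq_bigr do rewrite !mxE.
have [iJ|iJ] := boolP (i \in J); last first.
  rewrite mul0rn big1 // => k _; have [ik|_] := eqVneq i (enum_val k).
    by rewrite ik enum_valP in iJ.
  by rewrite mul0r.
rewrite (bigD1 (enum_rank_in iJ i)) //= big1 ?addr0 => [|k kn].
  by rewrite enum_rankK_in // eqxx mul1r [j == i]eq_sym.
have [ik|_] := eqVneq i (enum_val k); last by rewrite mul0r.
by case/eqP: kn; apply: enum_val_inj; rewrite enum_rankK_in.
Qed.

Lemma row_mask_mulE (R : realType) (n m : nat) (J : {set 'I_n})
    (U : 'M[R]_(n, m)) i j :
  (row_mask R J *m U) i j = if i \in J then U i j else 0.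
Proof.
by rewrite mul_diag_mx !mxE; case: ifP => _; rewrite ?mul1r ?mul0r.
Qed.

Lemma mxdot_row_mask (R : realType) (n m : nat) (J : {set 'I_n})
    (U : 'M[R]_(n, m)) :
  mxdot U U = mxdot (row_mask R J *m U) (row_mask R J *m U) +
              mxdot (row_mask R (~: J) *m U) (row_mask R (~: J) *m U).
Proof.
rewrite -big_split /=; apply: eq_bigr => i _; rewrite -big_split /=.
apply: eq_bigr => j _; rewrite !row_mask_mulE inE.
by case: ifP => _ /=; rewrite !mul0r ?addr0 ?add0r.
Qed.

(* Splitting the rows along [J] makes the two parts orthogonal: the rows in [J]
   are treated as an arbitrary matrix, the others have low rank. *)
Lemma row_sparse_low_rank_net (R : realType) (n p q s m : nat)
    (X : 'M[R]_(n, p)) (J : {set 'I_n}) :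
  (\rank X <= q)%N ->
  exists S : seq 'M[R]_(n, m),
  [/\ (size S <= 64 ^ (q * s + s * m + #|J| * m))%N,
      (forall V, V \in S -> mxdot V V <= 40)
    & forall (W : 'M[R]_(p, m)) (C g : 'M[R]_(n, m)), (\rank W <= s)%N ->
        row_mask R (~: J) *m C = 0 ->
        mxdot (X *m W + C) (X *m W + C) <= 1 ->
        exists2 V, V \in S & mxdot g (X *m W + C) <= mxdot g V].
Proof.
move=> rX.
have rXJ : (\rank (row_mask R (~: J) *m X) <= q)%N.
  by apply: leq_trans (mxrankM_maxr _ _) rX.
have [S1 [sS1 S1n S1P]] := @low_rank_net R n p q s m _ rXJ.
have [S2 [sS2 S2n S2P]] := @subspace_net R n n #|J| m _ (mxrank_row_mask R J).
exists [seq V1 + V2 | V1 <- S1, V2 <- S2]; split.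
- by rewrite size_allpairs expnD leq_mul.
- move=> _ /allpairsP[[V1 V2] [/= V1S V2S ->]].
  apply: le_trans (mxdot_sqD_le _ _) _.
  by have := S1n _ V1S; have := S2n _ V2S; lra.
move=> W C g rW CJ; set D := X *m W + C => D1.
have XW : row_mask R (~: J) *m X *m W = row_mask R (~: J) *m D.
  by rewrite /D mulmxDr CJ addr0 mulmxA.
have DE : D = row_mask R (~: J) *m X *m W + row_mask R J *m D.
  rewrite XW; apply/matrixP => i j; rewrite [RHS]mxE !row_mask_mulE inE.
  by case: (i \in J) => /=; rewrite ?addr0 ?add0r.
have D2 := mxdot_row_mask J D.
have [V1 V1S gV1] : exists2 V, V \in S1 &
    mxdot g (row_mask R (~: J) *m X *m W) <= mxdot g V.
  apply: S1P => //; rewrite XW; have := mxdot_ge0 (row_mask R J *m D); lra.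
have [V2 V2S gV2] : exists2 V, V \in S2 & mxdot g (row_mask R J *m D) <= mxdot g V.
  apply: S2P; have := mxdot_ge0 (row_mask R (~: J) *m D); lra.
exists (V1 + V2); first by apply/allpairsP; exists (V1, V2).
by rewrite DE !mxdotDr lerD.
Qed.

Local Open Scope classical_set_scope.
Local Open Scope ring_scope.

(** * Exponential moments of independent Gaussian variables *)

Section integral_weighted_comp.
Local Open Scope ereal_scope.
Import HBNNSimple.

(** The image under [Z] of the measure with density [g] is [c] times [nu]; the identity passes from
    indicators to simple functions by linearity, then to [f] by monotone convergence. It serves for
    densities, for laws and for independence. *)
Lemma ge0_integral_weighted_comp (d d' : measure_display) (T : measurableType d)
    (T' : measurableType d') (R : realType) (mu : {measure set T -> \bar R})
    (nu : {measure set T' -> \bar R}) (g : T -> R) (Z : T -> T') (c : R)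
    (f : T' -> R) :
  measurable_fun setT g -> (forall w, 0 <= g w)%R -> measurable_fun setT Z ->
  (forall D, measurable D ->
     \int[mu]_w (g w * \1_D (Z w))%:E = c%:E * nu D) ->
  measurable_fun setT f -> (forall x, 0 <= f x)%R ->
  \int[mu]_w (g w * f (Z w))%:E = c%:E * \int[nu]_x (f x)%:E.
Proof.
move=> mg g0 mZ gD mf f0.
have mEf : measurable_fun [set: T'] (fun x => (f x)%:E) by exact/measurable_EFinP.
pose f_ := nnsfun_approx measurableT mEf.
have fcvg x : EFin \o f_ ^~ x @ \oo --> (f x)%:E.
  by apply: cvg_nnsfun_approx => // y _; rewrite lee_fin.
have f_nd x m n : (m <= n)%N -> (f_ m x <= f_ n x)%R.
  by move=> mn; exact/lefP/nd_nnsfun_approx.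
have f_n n : \int[mu]_w (g w * f_ n (Z w))%:E = c%:E * \int[nu]_x (f_ n x)%:E.
  have mfn r : measurable (f_ n @^-1` [set r]) by exact: measurable_funPTI.
  have mind r : measurable_fun [set: T'] (\1_(f_ n @^-1` [set r]) : T' -> R).
    exact: measurable_indic.
  transitivity (\sum_(k \in range (f_ n))
      \int[mu]_w (k * (g w * \1_(f_ n @^-1` [set k]) (Z w)))%:E).
    rewrite -ge0_integral_fsum //.
    - apply: eq_integral => w _; rewrite fsumEFin // fimfunE mulr_fsumr.
      by congr EFin; apply: eq_fsbigr => k _; rewrite mulrCA.
    - move=> r; apply/measurable_EFinP; apply: measurable_funM => //.
      by apply: measurable_funM => //; exact: measurableT_comp.
    - move=> r w _; rewrite mulrCA lee_fin mulr_ge0 //.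
      by have := nnfun_muleindic_ge0 (f_ n) r (Z w); rewrite lee_fin.
  transitivity (c%:E * \sum_(k \in range (f_ n))
      \int[nu]_x (k * \1_(f_ n @^-1` [set k]) x)%:E).
    rewrite ge0_mule_fsumr; last first.
      move=> k; apply: integral_ge0 => x _.
      by have := nnfun_muleindic_ge0 (f_ n) k x.
    apply: eq_fsbigr => k _.
    have [k0|k0] := ltP k 0%R.
      rewrite preimage_nnfun0 // !integral0_eq ?mule0 // => x _;
      by rewrite indic0 !mulr0.
    under eq_integral do rewrite EFinM.
    rewrite ge0_integralZl_EFin //; last 2 first.
    - by move=> w _; rewrite lee_fin mulr_ge0.
    - apply/measurable_EFinP; apply: measurable_funM => //.
      exact: measurableT_comp.
    rewrite gD // integralZl_indic_nnsfun // integral_indic // setIT.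
    by rewrite muleCA.
  rewrite -ge0_integral_fsum //.
  - by congr (_ * _); apply: eq_integral => x _; rewrite fsumEFin // -fimfunE.
  - by move=> k; apply/measurable_EFinP; apply: measurable_funM.
  - by move=> k x _; exact: nnfun_muleindic_ge0.
have mf_ n : measurable_fun [set: T'] (f_ n : T' -> R) by [].
have lhs : \int[mu]_w (g w * f_ n (Z w))%:E @[n --> \oo] -->
           \int[mu]_w (g w * f (Z w))%:E.
  rewrite [X in _ --> X](_ : _ =
      \int[mu]_w limn (fun n => (g w * f_ n (Z w))%:E)); last first.
    apply: eq_integral => w _; apply/esym/cvg_lim => //.
    under eq_fun do rewrite EFinM.
    by rewrite EFinM; apply: cvgeZl => //; exact: fcvg.
  apply: cvg_monotone_convergence => //.
  - move=> n; apply/measurable_EFinP; apply: measurable_funM => //.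
    exact: measurableT_comp.
  - by move=> n w _; rewrite lee_fin mulr_ge0.
  - by move=> w _ m n mn; rewrite lee_fin ler_wpM2l // f_nd.
have rhs : c%:E * \int[nu]_x (f_ n x)%:E @[n --> \oo] -->
           c%:E * \int[nu]_x (f x)%:E.
  apply: cvgeZl => //.
  rewrite [X in _ --> X](_ : _ = \int[nu]_x limn (fun n => (f_ n x)%:E)); last first.
    by apply: eq_integral => x _; apply/esym/cvg_lim => //; exact: fcvg.
  apply: cvg_monotone_convergence => //.
  - by move=> n; apply/measurable_EFinP.
  - by move=> n x _; rewrite lee_fin.
  - by move=> x _ m n mn; rewrite lee_fin f_nd.
move: lhs; under eq_fun do rewrite f_n.
by move=> lhs; exact: (cvg_unique _ lhs rhs).
Qed.

End integral_weighted_comp.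

(** Completing the square: the centered density times [expR (t * x)] is
    [expR (sigma ^+ 2 * t ^+ 2 / 2)] times the density of mean [sigma ^+ 2 * t], whose mass is
    [1]. *)
Lemma normal_prob_expR (R : realType) (sigma t : R) : sigma != 0 ->
  (\int[normal_prob 0 sigma]_x (expR (t * x))%:E =
   (expR (sigma ^+ 2 * t ^+ 2 / 2))%:E)%E.
Proof.
move=> s0.
have mexp : measurable_fun [set: R] (fun x : R => expR (t * x)).
  by apply: measurableT_comp => //; exact: measurable_funM.
have dens : forall D : set R, measurable D ->
    (\int[lebesgue_measure]_x (normal_pdf 0 sigma x * \1_D (id x))%:E =
     1%:E * normal_prob 0 sigma D)%E.
  move=> D mD; rewrite mul1e /normal_prob [RHS]integral_mkcond.
  by apply: eq_integral => x _; rewrite epatch_indic.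
rewrite -[LHS]mul1e.
rewrite -(ge0_integral_weighted_comp (nu := normal_prob 0 sigma) _ _ _ dens mexp) //;
  last 2 first.
- exact: measurable_normal_pdf.
- by move=> x; exact: normal_pdf_ge0.
transitivity (\int[lebesgue_measure]_x
   ((expR (sigma ^+ 2 * t ^+ 2 / 2))%:E * (normal_pdf (sigma ^+ 2 * t) sigma x)%:E))%E.
  apply: eq_integral => x _; rewrite -EFinM; congr EFin.
  rewrite !normal_pdfE // mulrCA -!mulrA; congr (_ * _).
  rewrite /normal_fun -!expRD; congr expR; field => //.
rewrite ge0_integralZl_EFin ?expR_ge0 //; last 2 first.
- by move=> x _; rewrite lee_fin normal_pdf_ge0.
- by apply/measurable_EFinP; exact: measurable_normal_pdf.
by rewrite integral_normal_pdf mule1.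
Qed.

Lemma gaussian_mgf (d : measure_display) (T : measurableType d) (R : realType)
    (Pr : probability T R) (sigma t : R) (Z : {RV Pr >-> R}) :
  sigma != 0 -> centered_gaussian sigma Z ->
  (\int[Pr]_w (expR (t * Z w))%:E = (expR (sigma ^+ 2 * t ^+ 2 / 2))%:E)%E.
Proof.
move=> s0 gZ; rewrite -normal_prob_expR // -[RHS]mul1e.
have mexp : measurable_fun [set: R] (fun x : R => expR (t * x)).
  by apply: measurableT_comp => //; exact: measurable_funM.
have law : forall D : set R, measurable D ->
    (\int[Pr]_w (1 * \1_D (Z w))%:E = 1%:E * normal_prob 0 sigma D)%E.
  move=> D mD; rewrite mul1e -gZ // /distribution /pushforward.
  under eq_integral do rewrite mul1r.
  rewrite -[in RHS](setIT (_ @^-1` _)) -integral_indic //.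
  exact: measurable_funPTI.
rewrite -(ge0_integral_weighted_comp (nu := normal_prob 0 sigma) _ _ _ law mexp) //.
  by apply: eq_integral => w _; rewrite mul1r.
exact: (@measurable_funP _ _ _ _ setT Z).
Qed.

(** Independence is stated for events only, so indicators are replaced by the functions [F i] one
    index at a time, the product of the other factors acting as the weight. *)
Lemma independent_integral_prod (d : measure_display) (T : measurableType d)
    (R : realType) (Pr : probability T R) (I : finType) (Z : I -> {RV Pr >-> R})
    (F : I -> R -> R) (e : I -> R) :
  mutually_independent Z -> (forall i, measurable_fun [set: R] (F i)) ->
  (forall i x, 0 <= F i x) ->
  (forall i, \int[Pr]_w (F i (Z i w))%:E = (e i)%:E)%E ->
  (\int[Pr]_w (\prod_i F i (Z i w))%:E = (\prod_i e i)%:E)%E.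
Proof.
move=> indZ.
(* [s] lists the indices at which [F i] may be a general nonnegative function; elsewhere it is an
   indicator. *)
suff gen (s : seq I) : forall (F : I -> R -> R) (e : I -> R),
    (forall i, i \notin s -> exists2 D, measurable D & F i = \1_D) ->
    (forall i, measurable_fun [set: R] (F i)) ->
    (forall i x, 0 <= F i x) ->
    (forall i, \int[Pr]_w (F i (Z i w))%:E = (e i)%:E)%E ->
    (\int[Pr]_w (\prod_i F i (Z i w))%:E = (\prod_i e i)%:E)%E.
  by apply: (gen (enum I)) => i; rewrite mem_enum.
elim: s => [|i0 s IH] {}F {}e Fs mF F0 Fe.
  have /choice[D DP] : forall i, exists D, measurable D /\ F i = \1_D.
    by move=> i; have [//|D mD FD] := Fs i; exists D.
  have mD i : measurable (D i) by case: (DP i).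
  have mZD i : measurable (Z i @^-1` D i) by exact: measurable_funPTI.
  have eE i : (e i)%:E = Pr (Z i @^-1` D i).
    rewrite -Fe (DP i).2 -[in RHS](setIT (_ @^-1` _)) -integral_indic //.
  have prodE w : \prod_i F i (Z i w) =
      \1_(\bigcap_(i in [set` [set: I]%SET]) (Z i @^-1` D i)) w.
    rewrite indicE; have [ZD|/existsNP[i Di]] := pselect (forall i, D i (Z i w)).
      rewrite mem_set; last by move=> i _; exact: ZD.
      by rewrite big1 // => i _; rewrite (DP i).2 indicE mem_set.
    rewrite memNset; last by move=> /(_ i) /=; rewrite inE => /(_ isT).
    by rewrite (bigD1 i) //= (DP i).2 indicE memNset // mul0r.
  under eq_integral do rewrite prodE.
  rewrite integral_indic //; last exact: fin_bigcap_measurable.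
  rewrite setIT; apply: (etrans (indZ [set: I]%SET D mD)).
  rewrite -prodEFin; apply: eq_big => [i|i _]; first by rewrite inE.
  exact/esym/eE.
pose g w := \prod_(i | i != i0) F i (Z i w).
pose c := \prod_(i | i != i0) e i.
have mg : measurable_fun [set: T] g.
  rewrite /g; under eq_fun do rewrite -big_filter.
  by apply: measurable_prod => i _; exact: measurableT_comp.
have g0 w : 0 <= g w by apply: prodr_ge0 => i _.
(* With an indicator put at [i0] the induction hypothesis applies, and identifies the weighted law
   of [Z i0]. *)
have gD (D : set R) : measurable D ->
    (\int[Pr]_w (g w * \1_D (Z i0 w))%:E = c%:E * distribution Pr (Z i0) D)%E.
  move=> mD.
  have mZD : measurable (Z i0 @^-1` D) by exact: measurable_funPTI.
  pose F' i := if i == i0 then \1_D else F i.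
  pose e' i := if i == i0 then fine (Pr (Z i0 @^-1` D)) else e i.
  have := IH F' e'.
  have -> : (\int[Pr]_w (\prod_i F' i (Z i w))%:E =
             \int[Pr]_w (g w * \1_D (Z i0 w))%:E)%E.
    apply: eq_integral => w _; rewrite (bigD1 i0) //= /F' eqxx mulrC.
    by congr (_ * _)%:E; apply: eq_bigr => i /negPf ->.
  move=> ->; last first.
  - move=> i; rewrite /F' /e'; case: eqP => [->|_]; last exact: Fe.
    rewrite fineK ?fin_num_measure // -[in RHS](setIT (_ @^-1` _)).
    by rewrite -integral_indic.
  - by move=> i x; rewrite /F'; case: ifP.
  - by move=> i; rewrite /F'; case: ifP => // _; exact: measurable_indic.
  - move=> i si; rewrite /F'; case: eqVneq => [_|ii0]; first by exists D.
    by apply: Fs; rewrite inE negb_or ii0.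
  rewrite (bigD1 i0) //= {1}/e' eqxx mulrC EFinM fineK ?fin_num_measure //.
  congr (_ * _)%E; congr EFin; apply: eq_bigr => i /negPf.
  by rewrite /e' => ->.
have -> : (\int[Pr]_w (\prod_i F i (Z i w))%:E =
           \int[Pr]_w (g w * F i0 (Z i0 w))%:E)%E.
  by apply: eq_integral => w _; rewrite (bigD1 i0) //= mulrC.
rewrite (ge0_integral_weighted_comp (nu := distribution Pr (Z i0)) mg g0 _ gD) //.
rewrite ge0_integral_distribution //; last 2 first.
- exact/measurable_EFinP.
- by move=> x; rewrite lee_fin.
by rewrite [X in (_ * X)%E]Fe -EFinM mulrC [in RHS](bigD1 i0).
Qed.

(** * Uniform bound on the noise *)

Lemma measurable_mxdot_noise (d : measure_display) (T : measurableType d)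
    (R : realType) (Pr : probability T R) (n m : nat)
    (E : 'I_n * 'I_m -> {RV Pr >-> R}) (V : 'M[R]_(n, m)) :
  measurable_fun [set: T] (fun w => mxdot (noise_matrix E w) V).
Proof.
rewrite /mxdot; apply: measurable_sum => i; apply: measurable_sum => j.
under eq_fun do rewrite mxE.
by apply: measurable_funM => //; exact: (@measurable_funP _ _ _ _ setT (E (i, j))).
Qed.

Lemma noise_mgf (d : measure_display) (T : measurableType d) (R : realType)
    (Pr : probability T R) (n m : nat) (sigma : R)
    (E : 'I_n * 'I_m -> {RV Pr >-> R}) (V : 'M[R]_(n, m)) :
  sigma != 0 -> iid_gaussian_entries sigma E ->
  (\int[Pr]_w (expR (mxdot (noise_matrix E w) V))%:E =
   (expR (sigma ^+ 2 * mxdot V V / 2))%:E)%E.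
Proof.
move=> s0 [indE gE].
have dotE (U : 'M[R]_(n, m)) : mxdot U V = \sum_p V p.1 p.2 * U p.1 p.2.
  rewrite -(pair_bigA _ (fun i j => V i j * U i j)) /=.
  by apply: eq_bigr => i _; apply: eq_bigr => j _; rewrite mulrC.
transitivity (\int[Pr]_w (\prod_p expR (V p.1 p.2 * E p w))%:E)%E.
  apply: eq_integral => w _; rewrite dotE expR_sum; congr EFin.
  by apply: eq_bigr => -[i j] _; rewrite mxE.
rewrite (independent_integral_prod
  (F := fun p x => expR (V p.1 p.2 * x))
  (e := fun p => expR (sigma ^+ 2 * V p.1 p.2 ^+ 2 / 2)) indE) //.
- rewrite -expR_sum dotE -mulr_suml mulr_sumr.
  by under eq_bigr do rewrite expr2.
- by move=> p; apply: measurableT_comp => //; exact: measurable_funM.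
- by move=> p; exact: gaussian_mgf.
Qed.

Lemma sqr_le_4expR (R : realType) (y : R) : 0 <= y -> y ^+ 2 <= 4 * expR y.
Proof.
move=> y0; have e1 := expR_ge1Dx (y / 2).
have -> : expR y = expR (y / 2) ^+ 2 by rewrite expr2 -expRD; congr expR; field.
have y20 : 0 <= y / 2 by rewrite divr_ge0.
have : (y / 2) ^+ 2 <= expR (y / 2) ^+ 2.
  by rewrite lerXn2r ?nnegrE ?expR_ge0 //; lra.
by rewrite exprMn exprVn; lra.
Qed.

(** Solving for [v] gives [v = sigma * (21 * a + y / a)] with [a = sqrt L], and [r * v] is split
    through [r * v <= r ^ 2 / 8 + 2 * v ^ 2]. The deviation [y] costs [y ^ 2 <= 4 * expR y <= 4 * z]
    when positive and is dropped otherwise. *)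
Lemma exp_moment_linear_le (R : realType) (L sigma v z r : R) :
  1 <= L -> 0 < sigma -> expR (Num.sqrt L / sigma * v - 21 * L) <= z -> 0 <= r ->
  r * v <= r ^+ 2 / 8 + 4 * sigma ^+ 2 * (21 ^+ 2 * L + 4 * z).
Proof.
move=> L1 s0; set a := Num.sqrt L; set y := a / sigma * v - 21 * L => yz r0.
have aL : a ^+ 2 = L by rewrite sqr_sqrtr //; lra.
have a1 : 1 <= a by rewrite -(@sqrtr1 R) ler_sqrt //; lra.
have z0 : 0 <= z by apply: le_trans yz; exact: expR_ge0.
have vE : v = sigma * (21 * a + y / a).
  by rewrite /y -aL; field; rewrite !gt_eqF //; lra.
have [y0|y0] := leP y 0.
  have rv : r * v <= r * (21 * sigma * a).
    rewrite ler_wpM2l // vE.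
    have : sigma * (y / a) <= 0.
      by rewrite pmulr_rle0 // ler_pdivrMr ?mul0r //; lra.
    lra.
  have amgm : r * (21 * sigma * a) <= r ^+ 2 / 8 + 2 * (21 * sigma * a) ^+ 2.
    by have := sqr_ge0 (r - 4 * (21 * sigma * a)); rewrite !expr2; lra.
  have : 0 <= sigma ^+ 2 * z by rewrite mulr_ge0 // sqr_ge0.
  have : 0 <= sigma ^+ 2 * a ^+ 2 by rewrite mulr_ge0 // sqr_ge0.
  move: rv amgm; rewrite -aL !expr2; lra.
have y2 : y ^+ 2 <= 4 * z.
  by apply: le_trans (sqr_le_4expR (ltW y0)) _; lra.
have rv : r * v <= r * (sigma * (21 * a + y)).
  rewrite ler_wpM2l // vE (ler_wpM2l (ltW s0)) // lerD2l ler_pdivrMr; last by lra.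
  by rewrite ler_peMr // ltW.
have amgm : r * (sigma * (21 * a + y)) <=
    r ^+ 2 / 8 + 2 * (sigma * (21 * a + y)) ^+ 2.
  by have := sqr_ge0 (r - 4 * (sigma * (21 * a + y))); rewrite !expr2; lra.
have sq : (sigma * (21 * a + y)) ^+ 2 <= sigma ^+ 2 * (2 * (21 ^+ 2 * a ^+ 2 + y ^+ 2)).
  rewrite exprMn ler_wpM2l ?sqr_ge0 //.
  by have := sqr_ge0 (21 * a - y); rewrite !expr2; lra.
have sy : sigma ^+ 2 * y ^+ 2 <= sigma ^+ 2 * (4 * z).
  by rewrite ler_wpM2l ?sqr_ge0.
by move: rv amgm sq sy; rewrite -aL; lra.
Qed.

(** * Support weights and entropy of the nets *)

Lemma sum_set_expr_card (R : comRingType) (I : finType) (x : R) :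
  \sum_(J : {set I}) x ^+ #|J| = (1 + x) ^+ #|I|.
Proof.
rewrite -[RHS]prodr_const addrC.
rewrite (@bigA_distr R 0 1 *%R +%R I (fun=> x) (fun=> 1)) /=.
apply: eq_bigr => J _; rewrite -big_mkcond /= prodr_const.
by congr (_ ^+ _); apply: eq_card => i.
Qed.

(** [ln 64] pays for the net cardinality; the added [1] makes the rate at least [1] at once. *)
Definition net_rate (R : realType) : R := 1 + ln 64.

(** Logarithmic cost of a support of size [j]: the first term dominates the log-cardinality of its
    net, the second pays for the choice of the support. *)
Definition net_entropy (R : realType) (n m q s j : nat) : R :=
  net_rate R * (q * s + s * m + j * m)%N%:R + j%:R * ln n%:R.

Lemma net_rate_ge1 (R : realType) : 1 <= net_rate R.
Proof. by rewrite lerDl ln_ge0 // ler1n. Qed.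

Lemma net_entropy_ge1 (R : realType) (n m q s j : nat) :
  (0 < n)%N -> (0 < m)%N -> (0 < s)%N -> 1 <= net_entropy R n m q s j.
Proof.
move=> n0 m0 s0; rewrite -[1]addr0; apply: lerD; last first.
  by rewrite mulr_ge0 // ln_ge0 // ler1n.
rewrite mulr_ege1 ?net_rate_ge1 // ler1n.
by rewrite -addnA addn_gt0 orbC addn_gt0 muln_gt0 s0 m0.
Qed.

Lemma net_entropy_sizeP (R : realType) (n m q s j N : nat) : (0 < n)%N ->
  (N <= 64 ^ (q * s + s * m + j * m))%N ->
  N%:R * expR (- net_entropy R n m q s j) <= n%:R^-1 ^+ j.
Proof.
move=> n0 N64; rewrite /net_entropy opprD expRD.
have -> : expR (- (j%:R * ln n%:R)) = n%:R^-1 ^+ j :> R.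
  by rewrite -mulrN expRM_natl expRN lnK // posrE ltr0n.
rewrite mulrA ler_piMl ?exprn_ge0 ?invr_ge0 //.
rewrite expRN ler_pdivrMr ?expR_gt0 // mul1r.
apply: (@le_trans _ _ (64 ^ (q * s + s * m + j * m))%N%:R).
  by rewrite ler_nat.
rewrite natrX mulrC expRM_natl lerXn2r ?nnegrE ?expR_ge0 //.
by rewrite -[leLHS]lnK ?posrE // ler_expR lerDr.
Qed.

(* The number of nets of support size [j] is at most [n ^ j], which the
   [j ln n] part of the entropy absorbs. *)
Lemma noise_sup_bound (d : measure_display) (T : measurableType d)
    (R : realType) (Pr : probability T R) (n m p s : nat) (sigma : R)
    (X : 'M[R]_(n, p)) (E : 'I_n * 'I_m -> {RV Pr >-> R}) :
  (0 < n)%N -> (0 < m)%N -> (0 < s)%N -> 0 < sigma ->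
  iid_gaussian_entries sigma E ->
  exists Z : T -> R,
  [/\ measurable_fun [set: T] Z, (forall w, 0 <= Z w),
      (\int[Pr]_w (Z w)%:E <= (expR 1)%:E)%E
    & forall w (J : {set 'I_n}) (W : 'M[R]_(p, m)) (C : 'M[R]_(n, m)),
        (\rank W <= s)%N -> row_mask R (~: J)%SET *m C = 0 ->
        mxdot (noise_matrix E w) (X *m W + C) <=
        mxdot (X *m W + C) (X *m W + C) / 8 +
        4 * sigma ^+ 2 * (21 ^+ 2 * net_entropy R n m (\rank X) s #|J| + 4 * Z w)].
Proof.
move=> n0 m0 s0 sg0 iidE.
pose L (J : {set 'I_n}) := net_entropy R n m (\rank X) s #|J|.
have L1 J : 1 <= L J by exact: net_entropy_ge1.
have L0 J : 0 <= L J by exact: le_trans ler01 (L1 J).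
have netP J := row_sparse_low_rank_net s m J (leqnn (\rank X)).
pose S J := projT1 (cid (netP J)).
have SP J := projT2 (cid (netP J)).
(* This tilt makes the moment exponent [L J * |V| ^ 2 / 2], at most [20 * L J] since
   [|V| ^ 2 <= 40]; subtracting [21 * L J] then leaves at most [- L J]. *)
pose t J := Num.sqrt (L J) / sigma.
pose z J V w := expR (t J * mxdot (noise_matrix E w) V - 21 * L J).
pose Z w := \sum_(J : {set 'I_n}) \sum_(V <- S J) z J V w.
have mz J V : measurable_fun [set: T] (z J V).
  apply: measurableT_comp => //; apply: measurable_funB => //.
  by apply: measurable_funM => //; exact: measurable_mxdot_noise.
have z0 J V w : 0 <= z J V w by exact: expR_ge0.
have Z0 w : 0 <= Z w by apply: sumr_ge0 => J _; exact: sumr_ge0.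
have zle J V w : V \in S J -> z J V w <= Z w.
  move=> VS; rewrite /Z (bigD1 J) //= (big_rem V VS) /= -addrA lerDl.
  rewrite addr_ge0 ?sumr_ge0 // => J' _; exact: sumr_ge0.
have iz J V : V \in S J ->
    (\int[Pr]_w (z J V w)%:E <= (expR (- L J))%:E)%E.
  move=> VS; have V40 : mxdot V V <= 40 by case: (SP J) => _ /(_ _ VS).
  have -> : (\int[Pr]_w (z J V w)%:E =
     \int[Pr]_w ((expR (- (21 * L J)))%:E *
                 (expR (mxdot (noise_matrix E w) (t J *: V)))%:E))%E.
    by apply: eq_integral => w _; rewrite -EFinM -expRD mxdotZr addrC.
  rewrite ge0_integralZl_EFin ?expR_ge0 //; last first.
    apply/measurable_EFinP; apply: measurableT_comp => //.
    exact: measurable_mxdot_noise.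
  rewrite (@noise_mgf _ _ _ _ _ _ sigma) ?gt_eqF // -EFinM -expRD lee_fin ler_expR.
  rewrite mxdotZr mxdotZl.
  have -> : sigma ^+ 2 * (t J * (t J * mxdot V V)) / 2 = L J * (mxdot V V / 2).
    have sL : Num.sqrt (L J) ^+ 2 = L J by rewrite sqr_sqrtr.
    by rewrite -[in RHS]sL /t; field; rewrite gt_eqF.
  have : L J * (mxdot V V / 2) <= L J * 20.
    by rewrite ler_wpM2l // ler_pdivrMr // (le_trans V40) // -natrM.
  lra.
exists Z; split.
- by apply: measurable_sum => J; exact: measurable_sum.
- exact: Z0.
- have -> : (\int[Pr]_w (Z w)%:E =
      \sum_(J : {set 'I_n}) \sum_(V <- S J) \int[Pr]_w (z J V w)%:E)%E.
    under eq_integral do rewrite -sumEFin.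
    rewrite ge0_integral_sum //; last 2 first.
    + by move=> J; apply/measurable_EFinP; exact: measurable_sum.
    + by move=> J w _; rewrite lee_fin sumr_ge0.
    apply: eq_bigr => J _.
    under eq_integral do rewrite -sumEFin.
    rewrite ge0_integral_sum //; first by move=> V; exact/measurable_EFinP.
    by move=> V w _; rewrite lee_fin.
  apply: (@le_trans _ _ (\sum_(J : {set 'I_n}) n%:R^-1 ^+ #|J|)%:E); last first.
    (* The sum is [(1 + 1 / n) ^ n <= e]. *)
    rewrite sum_set_expr_card card_ord lee_fin.
    have -> : expR 1 = expR n%:R^-1 ^+ n :> R.
      by rewrite -expRM_natl mulfV // pnatr_eq0 -lt0n.
    by rewrite lerXn2r ?nnegrE ?expR_ge0 ?expR_ge1Dx // addr_ge0 ?invr_ge0.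
  rewrite -sumEFin; apply: lee_sum => J _.
  apply: (@le_trans _ _ (\sum_(V <- S J) (expR (- L J))%:E)%E).
    rewrite big_seq [leRHS]big_seq; apply: lee_sum => V; exact: iz.
  rewrite sumEFin lee_fin big_const_seq count_predT iter_addr_0 -[_ *+ size _]mulr_natl.
  by apply: net_entropy_sizeP => //; case: (SP J).
move=> w J W C rW CJ; set D := X *m W + C; set G := noise_matrix E w.
(* The zero matrix, which cannot be rescaled to norm [1], is treated apart. *)
have [D0|D0] := eqVneq (mxdot D D) 0.
  have -> : mxdot G D = 0.
    by rewrite (mxdot_eq0 D0) mxdot0r.
  rewrite D0 mul0r add0r.
  apply: mulr_ge0; first by rewrite mulr_ge0 ?sqr_ge0.
  by apply: addr_ge0; apply: mulr_ge0 => //; exact: L0.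
pose r := Num.sqrt (mxdot D D).
have rr : r ^+ 2 = mxdot D D by rewrite sqr_sqrtr // mxdot_ge0.
have r0 : r != 0 by rewrite -sqrf_eq0 rr.
have DrE : X *m (r^-1 *: W) + r^-1 *: C = r^-1 *: D.
  by rewrite -scalemxAr -scalerDr.
have [_ _ /(_ (r^-1 *: W) (r^-1 *: C) G)] := SP J.
rewrite DrE => /(_ _ _ _)[].
- by apply: leq_trans rW; exact: mxrank_scale.
- by rewrite -scalemxAr CJ scaler0.
- by rewrite mxdotZr mxdotZl -rr; rewrite le_eqVlt; apply/orP; left; apply/eqP; field.
move=> V VS GV.
have GD : mxdot G D = r * mxdot G (r^-1 *: D).
  by rewrite mxdotZr mulrA divff // mul1r.
have rge0 : 0 <= r by exact: sqrtr_ge0.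
rewrite GD; apply: le_trans (ler_wpM2l rge0 GV) _; rewrite -rr.
exact: exp_moment_linear_le (L1 J) sg0 (zle J V w VS) rge0.
Qed.

(** * Hard thresholding and the oracle inequality *)

Lemma frob_norm_sqr (R : realType) (n m : nat) (U : 'M[R]_(n, m)) :
  frob_norm U ^+ 2 = mxdot U U.
Proof.
rewrite /frob_norm sqr_sqrtr; last first.
  by apply: sumr_ge0 => i _; apply: sumr_ge0 => j _; rewrite sqr_ge0.
by apply: eq_bigr => i _; apply: eq_bigr => j _; rewrite expr2.
Qed.

Lemma l2_norm_sqr (R : realType) (m : nat) (u : 'rV[R]_m) :
  l2_norm u ^+ 2 = mxdot u u.
Proof.
rewrite /l2_norm sqr_sqrtr; last by apply: sumr_ge0 => j _; rewrite sqr_ge0.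
by rewrite /mxdot big_ord1; apply: eq_bigr => j _; rewrite expr2.
Qed.

Lemma l2_norm_ge0 (R : realType) (m : nat) (u : 'rV[R]_m) : 0 <= l2_norm u.
Proof. exact: sqrtr_ge0. Qed.

Lemma mxdot_row (R : realType) (n m : nat) (U : 'M[R]_(n, m)) :
  mxdot U U = \sum_i mxdot (row i U) (row i U).
Proof.
apply: eq_bigr => i _; rewrite /mxdot big_ord1.
by apply: eq_bigr => j _; rewrite !mxE.
Qed.

(** Cauchy-Schwarz from the square of [|v| u - |u| v]; vanishing norms are treated apart because a
    factor [2 |u| |v|] is cancelled. *)
Lemma mxdot_le_l2_norm (R : realType) (m : nat) (u v : 'rV[R]_m) :
  mxdot u v <= l2_norm u * l2_norm v.
Proof.
have [u0|u0] := eqVneq (l2_norm u) 0.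
  have /mxdot_eq0 -> : mxdot u u = 0 by rewrite -l2_norm_sqr u0 expr0n.
  by rewrite mxdot0l mulr_ge0 ?l2_norm_ge0.
have [v0|v0] := eqVneq (l2_norm v) 0.
  have /mxdot_eq0 -> : mxdot v v = 0 by rewrite -l2_norm_sqr v0 expr0n.
  by rewrite mxdot0r mulr_ge0 ?l2_norm_ge0.
have up : 0 < l2_norm u by rewrite lt_neqAle eq_sym u0 l2_norm_ge0.
have vp : 0 < l2_norm v by rewrite lt_neqAle eq_sym v0 l2_norm_ge0.
have := mxdot_ge0 (l2_norm v *: u - l2_norm u *: v).
rewrite mxdotBr !mxdotBl !mxdotZr !mxdotZl -!l2_norm_sqr (mxdotC v u).
set a := l2_norm u in up *; set b := l2_norm v in vp *; set x := mxdot u v.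
have -> : b * (b * a ^+ 2) - b * (a * x) - (a * (b * x) - a * (a * b ^+ 2)) =
   2 * (a * b) * (a * b - x) by ring.
by rewrite pmulr_rge0 ?subr_ge0 // !mulr_gt0.
Qed.

Lemma P_H_ge0 (R : realType) (t lambda : R) : 0 <= P_H t lambda.
Proof.
rewrite /P_H; case: ltP => [tl|_]; last by rewrite divr_ge0 // sqr_ge0.
have t0 := normr_ge0 t; rewrite -(real_normK (num_real t)).
have : 0 <= `|t| * (lambda - `|t|) by rewrite mulr_ge0 // subr_ge0 ltW.
by have := sqr_ge0 `|t|; rewrite !expr2; lra.
Qed.

(* Hard thresholding: minimizing [1/2 |c - z|^2 + P_H |c|] over [c] gives
   [min (1/2 |z|^2, lambda^2 / 2)], attained at [c = 0] or [c = z]. *)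
Lemma P_H_threshold (R : realType) (m : nat) (lambda : R) (c z : 'rV[R]_m) :
  0 <= lambda ->
  exists b : bool,
  2^-1 * (if b then 0 else mxdot z z) + (if b then lambda ^+ 2 / 2 else 0)
  <= 2^-1 * mxdot (c - z) (c - z) + P_H (l2_norm c) lambda.
Proof.
move=> l0; have cz := mxdot_le_l2_norm c z.
rewrite mxdotBr !mxdotBl -!l2_norm_sqr (mxdotC z c) /P_H.
set t := l2_norm c in cz *; set s := l2_norm z in cz *; set x := mxdot c z in cz *.
have t0 : 0 <= t by exact: l2_norm_ge0.
have s0 : 0 <= s by exact: l2_norm_ge0.
(* [true] stands for keeping [z] at cost [lambda ^ 2 / 2], [false] for replacing it by [0]. *)
rewrite ger0_norm //; case: (ltP t lambda) => tl; last first.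
  exists true; have := sqr_ge0 (t - s); rewrite !expr2; lra.
have [sl|ls] := leP s lambda.
  exists false; have : 0 <= t * (lambda - s) by rewrite mulr_ge0 // subr_ge0.
  rewrite !expr2; lra.
(* For [t < lambda], [(lambda - t) ^ 2 / 2 + P_H t lambda = lambda ^ 2 / 2]. *)
exists true; have : (lambda - t) ^+ 2 <= (s - t) ^+ 2.
  by rewrite lerXn2r ?nnegrE; lra.
by rewrite !expr2; lra.
Qed.

Lemma P_H_threshold_rows (R : realType) (n m : nat) (lambda : R)
    (C Z : 'M[R]_(n, m)) : 0 <= lambda ->
  exists J : {set 'I_n},
  2^-1 * mxdot (row_mask R J *m Z - Z) (row_mask R J *m Z - Z)
    + #|J|%:R * (lambda ^+ 2 / 2)
  <= 2^-1 * mxdot (C - Z) (C - Z) + \sum_i P_H (l2_norm (row i C)) lambda.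
Proof.
move=> l0.
have /choice[b bP] := fun i => P_H_threshold (row i C) (row i Z) l0.
exists [set i | b i]%SET.
rewrite !mxdot_row !mulr_sumr mulr_natl -sumr_const.
rewrite [X in _ + X <= _]big_mkcond -!big_split /=.
apply: ler_sum => i _; rewrite inE.
have -> : row i (row_mask R [set i0 | b i0]%SET *m Z - Z) =
          (if b i then 0 else - row i Z).
  apply/rowP => j; rewrite 2!mxE row_mask_mulE inE mxE.
  by case: (b i); rewrite !mxE ?subrr ?sub0r.
move: (bP i); rewrite -linearB /=; case: (b i); rewrite ?mxdot0r //.
by rewrite -(scaleN1r (row i Z)) mxdotZr mxdotZl !mulN1r opprK.
Qed.

Lemma row_penalty_le_Jrows (R : realType) (P : R -> R -> R) (n m : nat)
    (C : 'M[R]_(n, m)) (lambda K : R) :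
  P 0 lambda = 0 -> (forall t, P t lambda <= K) ->
  row_penalty P C lambda <= K * (Jrows C)%:R.
Proof.
move=> P0 PK; rewrite mulr_natr /Jrows -sumr_const /row_penalty.
rewrite [leRHS]big_mkcond /=; apply: ler_sum => i _; rewrite inE.
case: eqVneq => [-> | //] /=.
by rewrite (_ : l2_norm 0 = 0) ?P0 // /l2_norm big1 ?sqrtr0 // => j _; rewrite mxE expr0n.
Qed.

(* The quadratic part of [|D|^2 / 8 - <G, D>] in [C] is
   [1/8 |C - (4 G - X W + C0)|^2], so hard thresholding replaces [C] by a
   row-sparse matrix at no extra cost. *)
Lemma minimizer_oracle (R : realType) (P : R -> R -> R) (lambda cP a b : R)
    (n m p r : nat) (X : 'M[R]_(n, p)) (Bs B0 Bh : 'M[R]_(p, m))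
    (Cs C0 Ch G : 'M[R]_(n, m)) :
  0 <= lambda -> b <= lambda ^+ 2 / 8 -> dominates_P_H P lambda ->
  (forall t, P t lambda <= cP * lambda ^+ 2) ->
  is_global_minimizer P lambda X (X *m Bs + Cs + G) r Bh Ch ->
  (\rank B0 <= r)%N ->
  (forall (J : {set 'I_n}) (W : 'M[R]_(p, m)) (C : 'M[R]_(n, m)),
     (\rank W <= 2 * r)%N -> row_mask R (~: J)%SET *m C = 0 ->
     mxdot G (X *m W + C) <=
     mxdot (X *m W + C) (X *m W + C) / 8 + (a + b * #|J|%:R)) ->
  0 <= b ->
  Mloss X (Bh - Bs) (Ch - Cs) <=
  3 * Mloss X (B0 - Bs) (C0 - Cs) +
  4 * (a + (b + cP * lambda ^+ 2) * (Jrows C0)%:R).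
Proof.
move=> l0 bl [P0 PH] PcP [rBh hmin] rB0 Gsup b0.
rewrite /Mloss !frob_norm_sqr.
set Dh := X *m (Bh - Bs) + (Ch - Cs); set D0 := X *m (B0 - Bs) + (C0 - Cs).
pose W := Bh - B0.
have rW : (\rank W <= 2 * r)%N.
  rewrite mul2n -addnn; apply: leq_trans (mxrank_add _ _) _.
  by rewrite mxrank_opp leq_add.
pose D C := X *m W + (C - C0).
have DhE : Dh = D0 + D Ch.
  rewrite /Dh /D0 /D /W !mulmxBr; apply/matrixP => i j; rewrite !mxE; ring.
(* Both residuals are [G] minus an estimation error, so [|G| ^ 2] cancels from the two
   objectives. *)
have opt : 2^-1 * mxdot Dh Dh + row_penalty P Ch lambda <=
    2^-1 * mxdot D0 D0 + mxdot G (D Ch) + row_penalty P C0 lambda.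
  have := hmin B0 C0 rB0; rewrite /objective !frob_norm_sqr.
  have -> : X *m Bs + Cs + G - X *m Bh - Ch = G - Dh.
    by rewrite /Dh mulmxBr; apply/matrixP => i j; rewrite !mxE; ring.
  have -> : X *m Bs + Cs + G - X *m B0 - C0 = G - D0.
    by rewrite /D0 mulmxBr; apply/matrixP => i j; rewrite !mxE; ring.
  rewrite !mxdotBr !mxdotBl (mxdotC D0 G) (mxdotC Dh G) !DhE !mxdotDr; lra.
have penC0 : row_penalty P C0 lambda <= cP * lambda ^+ 2 * (Jrows C0)%:R.
  exact: row_penalty_le_Jrows.
pose PHh := \sum_i P_H (l2_norm (row i Ch)) lambda.
have penCh : PHh <= row_penalty P Ch lambda by apply: ler_sum => i _.
have PHh0 : 0 <= PHh by apply: sumr_ge0 => i _; exact: P_H_ge0.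
pose Z := 4 *: G - X *m W + C0.
have [J JP] := P_H_threshold_rows Ch Z l0.
have sqE C : mxdot (C - Z) (C - Z) =
    mxdot (D C) (D C) - 8 * mxdot G (D C) + 16 * mxdot G G.
  have -> : C - Z = D C - 4 *: G.
    by rewrite /D /Z; apply/matrixP => i j; rewrite !mxE; ring.
  rewrite !mxdotBr !mxdotBl !mxdotZr !mxdotZl (mxdotC (D C) G); ring.
pose J0 := [set i | row i C0 != 0]%SET.
have J0E : #|J0| = Jrows C0 by rewrite cardsE.
pose C' := row_mask R J *m Z.
(* Off [J :|: J0] both the thresholded matrix and [C0] vanish, so the noise bound is available with
   this support. *)
have C'J : row_mask R (~: (J :|: J0))%SET *m (C' - C0) = 0.
  apply/matrixP => i j; rewrite row_mask_mulE [RHS]mxE !inE negb_or negbK.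
  case: ifP => // /andP[iJ /eqP /rowP /(_ j)]; rewrite 2!mxE => C0i.
  by rewrite [LHS]mxE [X in _ + X]mxE C0i row_mask_mulE (negPf iJ) subrr.
have GC' := Gsup _ _ _ rW C'J.
have card_le : b * #|J :|: J0|%SET%:R <= b * #|J|%:R + b * (Jrows C0)%:R.
  by rewrite -mulrDr ler_wpM2l // -J0E -natrD ler_nat leq_card_setU.
have bJ : b * #|J|%:R <= lambda ^+ 2 / 8 * #|J|%:R by rewrite ler_wpM2r.
(* A quarter of the thresholding inequality is used: its [lambda ^ 2 / 8] per row of [J] absorbs the
   noise term [b * #|J|]. *)
have key : mxdot G (D Ch) <=
    mxdot (D Ch) (D Ch) / 8 + row_penalty P Ch lambda + a + b * (Jrows C0)%:R.
  move: JP GC'; rewrite -/C' -/PHh !sqE -/(D C'); lra.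
(* As [|D Ch| ^ 2 / 8 <= (|Dh| ^ 2 + |D0| ^ 2) / 4], a quarter of [|Dh| ^ 2] survives on the left,
   which produces the constants [3] and [4]. *)
have := mxdot_sqD_le Dh (- D0).
have -> : Dh - D0 = D Ch by rewrite DhE addrC addKr.
rewrite -scaleN1r mxdotZr mxdotZl; lra.
Qed.

(** * Expectation bound and choice of constants *)

(** The order of quantifiers makes [A0] absolute and lets [K] depend on [A] and [cP] only.
    Measurability of the loss is assumed since the minimizers are an arbitrary selection. *)
Theorem corollary1 (R : realType) :
  exists A0 : R, 0 < A0 /\ forall A : R, A0 <= A -> forall cP : R, 0 < cP ->
  exists K : R, 0 < K /\
  forall (n m p r : nat) (sigma : R) (X : 'M[R]_(n, p))
    (Bs : 'M[R]_(p, m)) (Cs : 'M[R]_(n, m)) (P : R -> R -> R) (lambda : R)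
    (d : measure_display) (T : measurableType d) (Pr : probability T R)
    (E : 'I_n * 'I_m -> {RV Pr >-> R})
    (Bh : T -> 'M[R]_(p, m)) (Ch : T -> 'M[R]_(n, m)),
  (0 < n)%N -> (0 < m)%N -> (0 < p)%N -> (1 <= r)%N -> 0 < sigma ->
  iid_gaussian_entries sigma E ->
  lambda = A * sigma * Num.sqrt (m%:R + ln n%:R) ->
  dominates_P_H P lambda ->
  bounded_nonconvex_penalty P cP lambda ->
  (forall w : T,
     is_global_minimizer P lambda X (X *m Bs + Cs + noise_matrix E w) r
       (Bh w) (Ch w)) ->
  measurable_fun [set: T] (fun w => Mloss X (Bh w - Bs) (Ch w - Cs)) ->
  ('E_Pr[fun w => Mloss X (Bh w - Bs) (Ch w - Cs)] <=
   K%:E * ereal_inf [set (oracle_bound sigma X r Bs Cs BC.1 BC.2)%:E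
                    | BC in [set BC : 'M[R]_(p, m) * 'M[R]_(n, m)
                            | (\rank BC.1 <= r)%N]])%E.
Proof.
pose k := net_rate R; have k1 : 1 <= k := net_rate_ge1 R.
have k0 : 0 <= k := le_trans ler01 k1.
(* With [b <= 4 * 21 ^ 2 * k * sigma ^ 2 * h] and [lambda ^ 2 = A ^ 2 * sigma ^ 2 * h], the
   absorption [b <= lambda ^ 2 / 8] follows from [A ^ 2 >= 32 * 21 ^ 2 * k]; as [A >= 1], a lower
   bound on [A] suffices. *)
exists (32 * 21 ^+ 2 * k); split.
  by rewrite mulr_gt0 ?mulr_gt0 ?exprn_gt0 // (lt_le_trans ltr01).
move=> A Ak cP cP0; pose e := expR 1 : R.
have A1 : 1 <= A.
  by apply: le_trans Ak; rewrite !mulr_ege1 ?exprn_ege1 // ler1n.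
have A0 : 0 <= A := le_trans ler01 A1.
have A2 : 32 * 21 ^+ 2 * k <= A ^+ 2 by rewrite (le_trans Ak) // expr2 ler_peMl.
have e0 : 0 <= e by exact: expR_ge0.
pose g := cP * A ^+ 2.
have g0 : 0 <= g by rewrite mulr_ge0 ?sqr_ge0 // ltW.
(* [3] comes from the loss of the competitor, [4 * g] from its penalty, [48 = 32 + 16] from the two
   parts of the entropy, [64 * e] from the mean of [Z]. *)
pose K := 3 + 4 * g + 48 * 21 ^+ 2 * k + 64 * e.
have K0 : 0 < K by rewrite /K; lra.
exists K; split=> //.
move=> n m p r sigma X Bs Cs P lambda d T Pr E Bh Ch n0 m0 p0 r1 s0 iidE lE
  domP [_ _ PcP] hmin mM.
have ln0 : 0 <= ln n%:R :> R by rewrite ln_ge0 // ler1n.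
pose h : R := m%:R + ln n%:R.
have h0 : 0 <= h by rewrite addr_ge0.
have l0 : 0 <= lambda.
  by rewrite lE mulr_ge0 ?sqrtr_ge0 // mulr_ge0 // ltW.
have l2 : lambda ^+ 2 = A ^+ 2 * sigma ^+ 2 * h.
  by rewrite lE !exprMn sqr_sqrtr.
have r20 : (0 < 2 * r)%N by rewrite muln_gt0.
have [Z [mZ Z0 iZ Zsup]] := noise_sup_bound X n0 m0 r20 s0 iidE.
pose q : R := (\rank X)%:R.
(* Moving [K] across reduces the infimum to one arbitrary competitor [(B0, C0)]. *)
rewrite -lee_pdivrMl //; apply: le_ereal_inf_tmp => _ [[B0 C0] /= rB0 <-].
rewrite lee_pdivrMl //.
(* The entropy at [s = 2 * r] is affine in [#|J|]: [a] collects its constant part and the noise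
   variable, [b] its slope. *)
pose a w := 4 * sigma ^+ 2 *
  (21 ^+ 2 * (k * (q * (2 * r)%:R + (2 * r)%:R * m%:R)) + 4 * Z w).
pose b := 4 * sigma ^+ 2 * 21 ^+ 2 * (k * m%:R + ln n%:R).
have s20 : 0 <= sigma ^+ 2 by exact: sqr_ge0.
have kh : k * m%:R + ln n%:R <= k * h.
  by rewrite /h mulrDr lerD2l ler_peMl.
have b0 : 0 <= b.
  apply: mulr_ge0; last by rewrite addr_ge0 // mulr_ge0.
  by apply: mulr_ge0; rewrite ?exprn_ge0 // mulr_ge0.
have b_le : b <= 4 * 21 ^+ 2 * (sigma ^+ 2 * (k * h)).
  have : sigma ^+ 2 * (k * m%:R + ln n%:R) <= sigma ^+ 2 * (k * h).
    by rewrite ler_wpM2l.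
  by rewrite /b; lra.
have bl : b <= lambda ^+ 2 / 8.
  apply: (le_trans b_le); rewrite l2.
  have : 32 * 21 ^+ 2 * k * (sigma ^+ 2 * h) <= A ^+ 2 * (sigma ^+ 2 * h).
    by rewrite ler_wpM2r // mulr_ge0.
  lra.
pose M0 := Mloss X (B0 - Bs) (C0 - Cs).
pose J0 : R := (Jrows C0)%:R.
have oracle w : Mloss X (Bh w - Bs) (Ch w - Cs) <=
    3 * M0 + 4 * (a w + (b + cP * lambda ^+ 2) * J0).
  apply: (minimizer_oracle C0 l0 bl domP PcP (hmin w) rB0 _ b0) => J W C rW CJ.
  apply: le_trans (Zsup w J W C rW CJ) _; rewrite lerD2l /a /b.
  by rewrite /net_entropy -/k !natrD !natrM -/q; lra.
(* Deterministic part of the oracle bound; what remains is [64 * sigma ^ 2 * Z w]. *)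
pose c := 3 * M0 + 4 *
  (4 * sigma ^+ 2 * (21 ^+ 2 * (k * (q * (2 * r)%:R + (2 * r)%:R * m%:R))) +
   (b + cP * lambda ^+ 2) * J0).
have M00 : 0 <= M0 by rewrite /M0 /Mloss sqr_ge0.
have J00 : 0 <= J0 by [].
have q0 : 0 <= q by [].
have c0 : 0 <= c.
  rewrite /c; apply: addr_ge0; first exact: mulr_ge0.
  apply: mulr_ge0 => //; apply: addr_ge0.
    apply: mulr_ge0; first exact: mulr_ge0.
    apply: mulr_ge0; first exact: exprn_ge0.
    by apply: mulr_ge0 => //; apply: addr_ge0; exact: mulr_ge0.
  apply: mulr_ge0 => //; apply: addr_ge0 => //.
  by rewrite mulr_ge0 ?sqr_ge0 // ltW.
have -> : ('E_Pr[fun w => Mloss X (Bh w - Bs) (Ch w - Cs)] =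
   \int[Pr]_w (Mloss X (Bh w - Bs) (Ch w - Cs))%:E)%E by rewrite unlock.
apply: (@le_trans _ _ (c%:E + (64 * sigma ^+ 2)%:E * e%:E)%E).
  apply: (@le_trans _ _ (\int[Pr]_w (c%:E + (64 * sigma ^+ 2)%:E * (Z w)%:E))%E).
    apply: ge0_le_integral => //.
    - by move=> w _; rewrite lee_fin /Mloss sqr_ge0.
    - exact/measurable_EFinP.
    - apply: emeasurable_funD => //; apply: emeasurable_funM => //.
      exact/measurable_EFinP.
    - move=> w _; rewrite -EFinM -EFinD lee_fin.
      by apply: le_trans (oracle w) _; rewrite /c /a; lra.
  rewrite ge0_integralD //; last 2 first.
  - move=> w _; rewrite -EFinM lee_fin.
    by apply: mulr_ge0 => //; exact: mulr_ge0.
  - apply: emeasurable_funM => //; exact/measurable_EFinP.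
  have -> : (\int[Pr]_w c%:E = c%:E)%E.
    rewrite integral_cst // -[RHS]mule1; congr (_ * _)%E.
    exact: probability_setT.
  rewrite leeD2l //.
  rewrite ge0_integralZl_EFin //; last 3 first.
  - by move=> w _; rewrite lee_fin.
  - exact/measurable_EFinP.
  - exact: mulr_ge0.
  by rewrite lee_pmul2l // lte_fin mulr_gt0 // exprn_gt0.
rewrite -EFinM -EFinD -EFinM lee_fin /oracle_bound -/M0 -/q -/J0.
set u := sigma ^+ 2 * (q + m%:R) * r%:R.
pose v := sigma ^+ 2 * J0 * h.
have -> : M0 + u + sigma ^+ 2 * J0 * m%:R + sigma ^+ 2 * J0 * ln n%:R = M0 + u + v.
  by rewrite /v /h; ring.
have v0 : 0 <= v by apply: mulr_ge0 => //; exact: mulr_ge0.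
(* As [m * r >= 1], the rank term [u] can absorb the mean of the remainder, of order [sigma ^ 2]. *)
have u_ge : sigma ^+ 2 <= u.
  rewrite /u -mulrA ler_peMr //.
  have : 1 <= m%:R * r%:R :> R by rewrite -natrM ler1n muln_gt0 m0.
  have : 0 <= q * r%:R by rewrite mulr_ge0.
  lra.
have u0 : 0 <= u by exact: le_trans u_ge.
have cE : c <= 3 * M0 + 32 * 21 ^+ 2 * (k * u) + 16 * 21 ^+ 2 * (k * v) + 4 * (g * v).
  have : b * J0 <= 4 * 21 ^+ 2 * (k * v).
    apply: le_trans (ler_wpM2r J00 b_le) _.
    by rewrite le_eqVlt; apply/orP; left; apply/eqP; rewrite /v; ring.
  have -> : c = 3 * M0 + 32 * 21 ^+ 2 * (k * u) + 4 * (b * J0) + 4 * (g * v).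
    by rewrite /c l2 /u /v /g natrM; ring.
  lra.
have eu : e * sigma ^+ 2 <= e * u by rewrite ler_wpM2l.
have KE : K * (M0 + u + v) = 3 * M0 + 3 * u + 3 * v
    + 4 * (g * M0) + 4 * (g * u) + 4 * (g * v)
    + 48 * 21 ^+ 2 * (k * M0) + 48 * 21 ^+ 2 * (k * u) + 48 * 21 ^+ 2 * (k * v)
    + 64 * (e * M0) + 64 * (e * u) + 64 * (e * v).
  by rewrite /K /g; ring.
have gM0 := mulr_ge0 g0 M00; have gu := mulr_ge0 g0 u0; have gv := mulr_ge0 g0 v0.
have kM0 := mulr_ge0 k0 M00; have ku := mulr_ge0 k0 u0; have kv := mulr_ge0 k0 v0.
have eM0 := mulr_ge0 e0 M00; have ev := mulr_ge0 e0 v0.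
rewrite KE; lra.
Qed.
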